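(* Let $\Delta t>0$, and let ${\bm u}^k$, ${\bm u}^n$, ${\bm u}^{n-1}$ be discrete states (at pseudotime level $k$ and physical time levels $n$, $n-1$) with values ${\bm u}=(\rho,{\bm m},\rho E)\in\mathbb R\times\mathbb R^3\times\mathbb R$ at each of finitely many solution points, and ${\bm R}^k=(R^\rho,{\bm R}^m,R^E)^k$ the discrete spatial residual evaluated at ${\bm u}^k$. For $\Delta\tau>0$ define ${\bm u}^{k+1}$ at each solution point, where $J>0$ is the metric Jacobian at the point, by the dual time-stepping BDF2 update $$J{\bm u}^{k+1}=\frac{2\Delta t}{2\Delta t+3\Delta\tau}\left(J{\bm u}^k+\frac{2\Delta\tau}{\Delta t}J{\bm u}^n-\frac{\Delta\tau}{2\Delta t}J{\bm u}^{n-1}+\Delta\tau\,{\bm R}^k\right).$$ Let $\Delta\tau_2^{\rho}\in(0,+\infty]$ be the density-positivity bound defined in the context. If ${\bm u}^k$ is in the admissible set, i.e. $\rho^k>0$ and $(\rho e)^k>0$ at all solution points, then there exists $\Delta\tau$ with $0<\Delta\tau\le\Delta\tau_2^{\rho}$ such that $\rho^{k+1}>0$ and $(\rho e)^{k+1}>0$ at all solution points.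
   Context: For a state ${\bm u}=(\rho,{\bm m},\rho E)$ with $\rho\neq0$ (density, momentum, total energy), the total internal energy is $\rho e=\rho E-\dfrac{\|{\bm m}\|^2}{2\rho}$, where $\|\cdot\|$ is the Euclidean norm in $\mathbb R^3$. The residual is ${\bm R}^k=\theta_f{\bm R}^k_p+(1-\theta_f){\bm R}^k_1$, where ${\bm R}_1^k$ and ${\bm R}_p^k$ are the (finite) right-hand sides, evaluated at ${\bm u}^k$, of a first-order and a $p$th-order semi-discrete spatial discretization of the regularized compressible Navier--Stokes equations and $\theta_f\in[0,1]$ is a flux limiter constant on each element; ${\bm R}^k$ does not depend on $\Delta\tau$. The solution points are indexed by $(i_1,i_2,i_3)$ on tensor-product Legendre-Gauss-Lobatto grids in curvilinear coordinates $\xi_1,\xi_2,\xi_3$. The bound is $$\Delta\tau^{\rho}_2=\min_{i_1,i_2,i_3}\ \frac{1}{\dfrac{2}{J_{i_1i_2i_3}}\displaystyle\sum_{d=1}^{3}\frac{\mathscr D^{+}_{i_d}+\mathscr D^{-}_{i_d}}{\Delta\bar\xi_{i_d}}-\left(\dfrac{2}{\Delta t}\dfrac{\rho^{n}}{\rho^{k}}-\dfrac{1}{2\Delta t}\dfrac{\rho^{n-1}}{\rho^{k}}\right)},$$ where densities are taken at the point $(i_1,i_2,i_3)$, a point with nonpositive denominator contributes $+\infty$, $\Delta\bar\xi_{i_d}>0$ is the control-volume width in direction $d$, and $\mathscr D^{\pm}_{i_d}\ge |\hat{\bar m}^{\pm}_{i_d}|/(2\rho^{\pm}_{i_d,A})\ge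 0$ are the mass-dissipation coefficients of the first-order scheme. Here $\rho^{\pm}_{i_d,A}>0$ is the arithmetic mean of the densities (at level $k$) at the point and at its neighbour in the $\pm\xi_d$ direction, and $\hat{\bar m}^{\pm}_{i_d}\in\mathbb R$ is the mass component of the two-point entropy-conservative inviscid flux at the flux point between them. *)

(* Defs.v *)
From HB Require Import structures.
From mathcomp Require Import all_boot all_order all_algebra.
From mathcomp Require Import reals constructive_ereal.

Set Implicit Arguments.
Unset Strict Implicit.
Unset Printing Implicit Defensive.

Import Order.TTheory GRing.Theory Num.Theory.

Local Open Scope ring_scope.

(* A state (rho, m, rho E) in R x R^3 x R. The factors R^o make the product a
   vector space over R, so that updates are written with +, - and *:. *)
Definition state (R : realType) : Type := (R^o * 'rV[R]_3 * R^o)%type.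

Definition density (R : realType) (u : state R) : R := u.1.1.
Definition momentum (R : realType) (u : state R) : 'rV[R]_3 := u.1.2.
Definition total_energy (R : realType) (u : state R) : R := u.2.

(* The library norm on row vectors is the sup norm, hence this definition. *)
Definition enorm (R : realType) (m : 'rV[R]_3) : R :=
  Num.sqrt (\sum_(i < 3) m 0 i ^+ 2).

Definition internal_energy (R : realType) (u : state R) : R :=
  total_energy u - enorm (momentum u) ^+ 2 / (2 * density u).

(* A solution point is an element of the mesh together with a multi-index
   (i_1, i_2, i_3) on a tensor-product grid with p + 1 points per direction. *)
Definition point (E : finType) (p : nat) : finType :=
  (E * {ffun 'I_3 -> 'I_p.+1})%type.

Definition dstate (R : realType) (E : finType) (p : nat) : Type :=
  point E p -> state R.

Definition admissible (R : realType) (E : finType) (p : nat)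
    (u : dstate R E p) : Prop :=
  forall x, 0 < density (u x) /\ 0 < internal_energy (u x).

(* Sides of a point in a direction d are booleans: true is +xi_d and false is
   -xi_d. The result is None when the adjacent flux point is on the boundary of
   the element. *)
Definition inner_neighbour (E : finType) (p : nat)
    (x : point E p) (d : 'I_3) (s : bool) : option (point E p) :=
  let move (j : nat) : point E p :=
    (x.1, [ffun c => if c == d then inord j else x.2 c]) in
  if s then (if (x.2 d < p)%N then Some (move (x.2 d).+1) else None)
  else (if (0 < x.2 d)%N then Some (move (x.2 d).-1) else None).

(* State on the other side of the flux point. Across an element face,
   face x d s is either the matching solution point of the adjacent element or,
   on the boundary of the domain, a prescribed boundary state. Values of face
   at flux points interior to an element are irrelevant. *)
Definition neighbour_state (R : realType) (E : finType) (p : nat)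
    (face : point E p -> 'I_3 -> bool -> point E p + state R)
    (u : dstate R E p) (x : point E p) (d : 'I_3) (s : bool) : state R :=
  match inner_neighbour x d s with
  | Some y => u y
  | None => match face x d s with inl y => u y | inr g => g end
  end.

Definition density_mean (R : realType) (E : finType) (p : nat)
    (face : point E p -> 'I_3 -> bool -> point E p + state R)
    (u : dstate R E p) (x : point E p) (d : 'I_3) (s : bool) : R :=
  (density (u x) + density (neighbour_state face u x d s)) / 2.

(* flux x d s is the two-point inviscid flux in the direction xi_d at the flux
   point of x on the side s; it may depend on the metric terms there. A flux
   lives in the same space as a state, and its first component is the mass
   component. *)
Definition mass_flux (R : realType) (E : finType) (p : nat)
    (face : point E p -> 'I_3 -> bool -> point E p + state R)
    (flux : point E p -> 'I_3 -> bool -> state R -> state R -> state R)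
    (u : dstate R E p) (x : point E p) (d : 'I_3) (s : bool) : R :=
  density (flux x d s (u x) (neighbour_state face u x d s)).

(* The limiter theta takes one value per element. *)
Definition residual (R : realType) (E : finType) (p : nat)
    (theta : E -> R) (Rp R1 : dstate R E p -> dstate R E p)
    (u : dstate R E p) : dstate R E p :=
  fun x => theta x.1 *: Rp u x + (1 - theta x.1) *: R1 u x.

Definition bdf2_rhs (R : realType) (E : finType) (p : nat)
    (J : point E p -> R) (dt dtau : R) (uk un unm1 Rk : dstate R E p) :
    dstate R E p :=
  fun x => (2 * dt / (2 * dt + 3 * dtau)) *:
    (J x *: uk x + (2 * dtau / dt) *: (J x *: un x)
     - (dtau / (2 * dt)) *: (J x *: unm1 x) + dtau *: Rk x).

Definition bdf2_step (R : realType) (E : finType) (p : nat)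
    (J : point E p -> R) (dt dtau : R) (uk un unm1 Rk : dstate R E p) :
    dstate R E p :=
  fun x => (J x)^-1 *: bdf2_rhs J dt dtau uk un unm1 Rk x.

(* bdf2_step is the unique solution u of J u = bdf2_rhs. *)
Lemma bdf2_stepP (R : realType) (E : finType) (p : nat)
    (J : point E p -> R) (dt dtau : R) (uk un unm1 Rk u : dstate R E p)
    (x : point E p) : 0 < J x ->
  J x *: u x = bdf2_rhs J dt dtau uk un unm1 Rk x <->
  u x = bdf2_step J dt dtau uk un unm1 Rk x.
Proof.
move=> J_gt0; have J_neq0 : J x != 0 by rewrite gt_eqF.
rewrite /bdf2_step; split=> [<-|->].
  by rewrite scalerA mulVf // scale1r.
by rewrite scalerA divff // scale1r.
Qed.

(* Dm x d s is the mass-dissipation coefficient at the flux point of x on the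
   side s in the direction d, and width e d i the control-volume width in the
   direction d of the points with i_d = i in the element e. *)
Definition bound_denominator (R : realType) (E : finType) (p : nat)
    (J : point E p -> R) (width : E -> 'I_3 -> 'I_p.+1 -> R)
    (Dm : point E p -> 'I_3 -> bool -> R) (dt : R)
    (uk un unm1 : dstate R E p) (x : point E p) : R :=
  2 / J x * (\sum_(d < 3) (Dm x d true + Dm x d false) / width x.1 d (x.2 d))
  - (2 / dt * (density (un x) / density (uk x))
     - 1 / (2 * dt) * (density (unm1 x) / density (uk x))).

Definition dtau_bound (R : realType) (E : finType) (p : nat)
    (J : point E p -> R) (width : E -> 'I_3 -> 'I_p.+1 -> R)
    (Dm : point E p -> 'I_3 -> bool -> R) (dt : R)
    (uk un unm1 : dstate R E p) : \bar R :=
  \big[Order.min/+oo%E]_(x : point E p)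
    (let q := bound_denominator J width Dm dt uk un unm1 x in
     if 0 < q then (1 / q)%:E else +oo%E).

(* Main.v *)
Require Import Defs.
From HB Require Import structures.
From mathcomp Require Import all_boot all_order all_algebra.
From mathcomp Require Import reals constructive_ereal.
From mathcomp Require Import ring lra.

Set Implicit Arguments.
Unset Strict Implicit.
Unset Printing Implicit Defensive.

Import Order.TTheory GRing.Theory Num.Theory.

Local Open Scope ring_scope.

(** With fixed data, [bdf2_step] is a positive multiple of [uk + dtau *: w] for a
    direction [w] that does not depend on [dtau].  The admissible set is a cone,
    cut out by the strict inequalities [rho > 0] and [2 rho (rho E) - |m|^2 > 0].
    Along the ray the first is affine and the second quadratic in [dtau], so both
    persist for all small [dtau > 0]; there are finitely many points, and each
    contributes a positive number to the minimum defining [dtau_bound]. *)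

(** Asking for a whole interval of parameters, not a single witness, makes such properties stable
    under conjunction. *)
Definition for_small_pos (R : realType) (P : R -> Prop) : Prop :=
  exists2 t0, 0 < t0 & forall t, 0 < t <= t0 -> P t.

Lemma for_small_pos_and (R : realType) (P Q : R -> Prop) :
  for_small_pos P -> for_small_pos Q -> for_small_pos (fun t => P t /\ Q t).
Proof.
move=> [a a_gt0 Pa] [b b_gt0 Qb]; exists (Num.min a b).
  by rewrite lt_min a_gt0.
by move=> t; rewrite le_min => /and3P[t_gt0 ta tb]; split;
  [apply: Pa | apply: Qb]; apply/andP.
Qed.

(** Finiteness of [T] matters: the common threshold is a minimum of finitely many positive ones,
    whereas an infinite family could have infimum 0. *)
Lemma for_small_pos_forall (R : realType) (T : finType) (P : T -> R -> Prop) :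
  (forall x, for_small_pos (P x)) -> for_small_pos (fun t => forall x, P x t).
Proof.
move=> smallP.
suff [t0 t0_gt0 Pt0] : for_small_pos (fun t => {in enum T, forall x, P x t}).
  by exists t0 => // t /Pt0 Pt x; apply: Pt; rewrite mem_enum.
elim: (enum T) => [|x s IHs]; first by exists 1.
have [t0 t0_gt0 Pt0] := for_small_pos_and (smallP x) IHs.
exists t0 => // t /Pt0[Px Ps] y; rewrite inE => /predU1P[-> //|].
exact: Ps.
Qed.

(** For [t <= 1] the perturbation is at least [- t * (|b| + |c|)]. The extra 1 in [k] keeps [a / k]
    well defined and leaves a margin of [t] that makes the inequality strict. *)
Lemma for_small_pos_quadratic (R : realType) (a b c : R) :
  0 < a -> for_small_pos (fun t => 0 < a + t * b + t ^+ 2 * c).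
Proof.
move=> a_gt0; set k := `|b| + `|c| + 1.
have k_gt0 : 0 < k by rewrite ltr_wpDl // addr_ge0.
exists (Num.min 1 (a / k)); first by rewrite lt_min ltr01 divr_gt0.
move=> t; rewrite le_min ler_pdivlMr // => /and3P[t_gt0 t_le1 tk].
have tb : - (t * `|b|) <= t * b.
  by rewrite -mulrN ler_pM2l // lerNl -normrN ler_norm.
have tc : - (t * `|c|) <= t ^+ 2 * c.
  rewrite expr2 -mulrA -mulrN ler_pM2l //.
  have : - (t * c) <= `|t * c| by rewrite -normrN ler_norm.
  have : t * `|c| <= `|c| by rewrite ler_piMl.
  by rewrite normrM (gtr0_norm t_gt0); lra.
by move: tk; rewrite /k !mulrDr mulr1; lra.
Qed.

Lemma enorm_sqr (R : realType) (m : 'rV[R]_3) :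
  enorm m ^+ 2 = \sum_(i < 3) m 0 i ^+ 2.
Proof. by rewrite sqr_sqrtr // sumr_ge0 // => i _; apply: sqr_ge0. Qed.

(** Clearing the denominator [2 * density u] turns the condition into positivity of a quadratic form
    in the state, which behaves well under scaling and along lines. *)
Lemma internal_energy_gt0 (R : realType) (u : state R) : 0 < density u ->
  (0 < internal_energy u) =
  (0 < 2 * density u * total_energy u - \sum_(i < 3) momentum u 0 i ^+ 2).
Proof.
move=> rho_gt0; have rho2_gt0 : 0 < 2 * density u by rewrite mulr_gt0.
by rewrite /internal_energy enorm_sqr !subr_gt0 ltr_pdivrMr // mulrC.
Qed.

(** Pointwise form of [admissible], convertible to it at each point. *)
Definition admissible_state (R : realType) (u : state R) : Prop :=
  0 < density u /\ 0 < internal_energy u.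

Lemma admissible_stateZ (R : realType) (c : R) (u : state R) :
  0 < c -> admissible_state u -> admissible_state (c *: u : state R).
Proof.
move=> c_gt0 [rho_gt0]; have crho_gt0 : 0 < density (c *: u : state R).
  exact: mulr_gt0.
rewrite internal_energy_gt0 // => eps_gt0; split=> //.
rewrite internal_energy_gt0 //.
have -> : \sum_(i < 3) momentum (c *: u : state R) 0 i ^+ 2 =
    c ^+ 2 * \sum_(i < 3) momentum u 0 i ^+ 2.
  by rewrite mulr_sumr; apply: eq_bigr => i _; rewrite mxE exprMn.
have -> : density (c *: u : state R) = c * density u by [].
have -> : total_energy (c *: u : state R) = c * total_energy u by [].
rewrite (_ : 2 * _ * _ = c ^+ 2 * (2 * density u * total_energy u)); last by ring.
by rewrite -mulrBr mulr_gt0 // exprn_gt0.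
Qed.

Lemma admissible_state_ray (R : realType) (u w : state R) : admissible_state u ->
  for_small_pos (fun t => admissible_state (u + t *: w : state R)).
Proof.
move=> [rho_gt0]; rewrite internal_energy_gt0 // => eps_gt0.
(* Coefficients of [t] and [t ^+ 2] in the quadratic form at [u + t *: w]: [b] is twice its polar
   form at [u] and [w], and [c] its value at [w]. *)
pose b := 2 * (density u * total_energy w + density w * total_energy u)
  - 2 * \sum_(i < 3) momentum u 0 i * momentum w 0 i.
pose c := 2 * density w * total_energy w - \sum_(i < 3) momentum w 0 i ^+ 2.
have [t0 t0_gt0 small] := for_small_pos_and
  (for_small_pos_quadratic (density w) 0 rho_gt0)
  (for_small_pos_quadratic b c eps_gt0).
exists t0 => // t /small[]; rewrite mulr0 addr0 => rhot_gt0 epst_gt0.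
split=> //; rewrite internal_energy_gt0 //.
have -> : density (u + t *: w : state R) = density u + t * density w by [].
have -> : total_energy (u + t *: w : state R)
  = total_energy u + t * total_energy w by [].
have -> : \sum_(i < 3) momentum (u + t *: w : state R) 0 i ^+ 2 =
    \sum_(i < 3) momentum u 0 i ^+ 2
    + 2 * t * (\sum_(i < 3) momentum u 0 i * momentum w 0 i)
    + t ^+ 2 * \sum_(i < 3) momentum w 0 i ^+ 2.
  by rewrite !mulr_sumr -!big_split; apply: eq_bigr => i _; rewrite !mxE /=; ring.
by congr (0 < _): epst_gt0; rewrite /b /c; ring.
Qed.

(** The factor [j^-1] commutes past [c] and cancels [j] in every term except the residual [r]. Only
    the module axioms are involved, hence the abstract [V]. *)
Lemma bdf2_ray (F : fieldType) (V : lmodType F) (j c dt dtau : F)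
    (a b d r : V) : j != 0 ->
  j^-1 *: (c *: (j *: a + (2 * dtau / dt) *: (j *: b)
                 - (dtau / (2 * dt)) *: (j *: d) + dtau *: r)) =
  c *: (a + dtau *: ((2 / dt) *: b - (2 * dt)^-1 *: d + j^-1 *: r)).
Proof.
move=> j_neq0; rewrite [LHS]scalerA [j^-1 * _]mulrC -[LHS]scalerA; congr (_ *: _).
rewrite !(scalerDr, scalerN, scalerA) mulVf // scale1r !addrA.
have -> : j^-1 * (2 * dtau / dt * j) = dtau * (2 / dt).
  by rewrite mulrCA mulVf // mulr1 mulrAC mulrC.
have -> : j^-1 * (dtau / (2 * dt) * j) = dtau / (2 * dt).
  by rewrite mulrCA mulVf // mulr1.
by rewrite [j^-1 * _]mulrC.
Qed.

Lemma bdf2_step_ray (R : realType) (E : finType) (p : nat)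
    (J : point E p -> R) (dt dtau : R) (uk un unm1 Rk : dstate R E p)
    (x : point E p) : J x != 0 ->
  bdf2_step J dt dtau uk un unm1 Rk x =
  (2 * dt / (2 * dt + 3 * dtau)) *:
    (uk x + dtau *: ((2 / dt) *: un x - (2 * dt)^-1 *: unm1 x
                     + (J x)^-1 *: Rk x)).
Proof.
move=> J_neq0; exact: bdf2_ray.
Qed.

Lemma for_small_pos_le_dtau_bound (R : realType) (E : finType) (p : nat)
    (J : point E p -> R) (width : E -> 'I_3 -> 'I_p.+1 -> R)
    (Dm : point E p -> 'I_3 -> bool -> R) (dt : R) (uk un unm1 : dstate R E p) :
  for_small_pos
    (fun t => (t%:E <= dtau_bound J width Dm dt uk un unm1)%E).
Proof.
pose q := bound_denominator J width Dm dt uk un unm1.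
have [|t0 t0_gt0 small] := @for_small_pos_forall R _
    (fun x t => 0 < q x -> t <= 1 / q x).
  (* A nonpositive denominator imposes no constraint, so any positive threshold serves, here 1. *)
  move=> x; case: (ltP 0 (q x)) => q_sign; last by exists 1.
  by exists (1 / q x) => [|t /andP[]]; rewrite ?divr_gt0.
exists t0 => // t /small t_le; apply: le_bigmin; first exact: leey.
by move=> x _ /=; case: ifP => [/t_le|_]; rewrite ?lee_fin ?leey.
Qed.

Theorem mainTheorem3 (R : realType) (E : finType) (p : nat) (hp : (0 < p)%N)
    (J : point E p -> R) (hJ : forall x, 0 < J x)
    (width : E -> 'I_3 -> 'I_p.+1 -> R)
    (hwidth : forall e d i, 0 < width e d i)
    (face : point E p -> 'I_3 -> bool -> point E p + state R)
    (flux : point E p -> 'I_3 -> bool -> state R -> state R -> state R)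
    (Rp R1 : dstate R E p -> dstate R E p)
    (theta : E -> R) (htheta : forall e, 0 <= theta e <= 1)
    (dt : R) (hdt : 0 < dt)
    (uk un unm1 : dstate R E p)
    (Dm : point E p -> 'I_3 -> bool -> R)
    (hmean : forall x d s, 0 < density_mean face uk x d s)
    (hDm : forall x d s,
      `|mass_flux face flux uk x d s| / (2 * density_mean face uk x d s)
        <= Dm x d s)
    (huk : admissible uk) :
  exists dtau : R,
    [/\ 0 < dtau,
        (dtau%:E <= dtau_bound J width Dm dt uk un unm1)%E &
        admissible
          (bdf2_step J dt dtau uk un unm1 (residual theta Rp R1 uk))].
Proof.
set Rk := residual _ _ _ _.
have smallx x : for_small_pos
    (fun t => admissible_state (bdf2_step J dt t uk un unm1 Rk x)).
  have [t0 t0_gt0 small] := admissible_state_ray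
    ((2 / dt) *: un x - (2 * dt)^-1 *: unm1 x + (J x)^-1 *: Rk x) (huk x).
  exists t0 => // t t_small; rewrite bdf2_step_ray ?gt_eqF //.
  apply: admissible_stateZ (small t t_small); case/andP: t_small => t_gt0 _.
  by rewrite divr_gt0 ?addr_gt0 ?mulr_gt0.
have [t0 t0_gt0 small] := for_small_pos_and
  (for_small_pos_le_dtau_bound J width Dm dt uk un unm1)
  (for_small_pos_forall smallx).
(* The common threshold is itself an allowed pseudotime step, since the intervals are closed on the
   right. *)
have [|t0_le adm] := small t0; first by rewrite t0_gt0 lexx.
by exists t0.
Qed.
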